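(* Let $\Lambda$ be a finite or countable alphabet with $\#\Lambda\ge2$ and $\mu$ any shift-invariant probability measure on $\Lambda^{\mathbb N}$. If $S\subset\mathbb N$ is infinite with lower density $0$, then $S$ does not preserve simple $\mu$-normality (and hence does not preserve $\mu$-normality): there exists a $\mu$-normal $x\in\Lambda^{\mathbb N}$ such that $x|_S$ is not simply $\mu$-normal.
   Context: A point $x\in\Lambda^{\mathbb N}$ is $\mu$-normal if every finite block $B$ occurs in $x$ with limiting frequency $\mu([B])$ ($[B]$ the cylinder of sequences starting with $B$). $x$ is simply $\mu$-normal if each symbol $a\in\Lambda$ occurs in $x$ with limiting frequency $\mu([a])$. For $S=\{s_1<s_2<\dots\}$, $x|_S=(x_{s_1},x_{s_2},\dots)$. $S$ preserves (simple) $\mu$-normality if $x|_S$ is (simply) $\mu$-normal for every $\mu$-normal $x$. Lower density: $\underline d(S)=\liminf_n \#(S\cap\{1,\dots,n\})/n$. *)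

(* Defs.v *)
From HB Require Import structures.
From mathcomp Require Import all_boot all_order all_algebra.
From mathcomp Require Import all_classical all_reals all_analysis.
Set Implicit Arguments. Unset Strict Implicit. Unset Printing Implicit Defensive.
Import Order.TTheory GRing.Theory Num.Theory.
Local Open Scope classical_set_scope.
Local Open Scope ring_scope.

(* Sequences x : nat -> L, indexed from 0 (the paper's N = {1,2,...}; the
   shift of indices is immaterial). *)

Section Defs.
Variable L : pointedType.

Definition window (x : nat -> L) (i k : nat) : seq L :=
  [seq x (i + j)%N | j <- iota 0 k].

Definition cyl (B : seq L) : set (nat -> L) := [set x | window x 0 (size B) = B].

Definition cylinders : set (set (nat -> L)) := [set cyl B | B in [set: seq L]].

(* Lambda^N with the product sigma-algebra = sigma-algebra generated by cylinders *)
Definition seqspace := g_sigma_algebraType cylinders.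

Definition shift (x : nat -> L) : nat -> L := fun n => x n.+1.

Definition nocc (x : nat -> L) (B : seq L) (n : nat) : nat :=
  count (fun i => window x i (size B) == B) (iota 0 n).

Definition freq_to (R : realType) (x : nat -> L) (B : seq L) (l : \bar R) : Prop :=
  ((nocc x B n)%:R / n%:R : R)%:E @[n --> \oo] --> l.

Definition shift_invariant (R : realType) (mu : probability seqspace R) : Prop :=
  forall A : set seqspace, measurable A -> mu (shift @^-1` A) = mu A.

Definition normal (R : realType) (mu : probability seqspace R) (x : nat -> L) : Prop :=
  forall B : seq L, freq_to x B (mu (cyl B)).

Definition simply_normal (R : realType) (mu : probability seqspace R) (x : nat -> L) : Prop :=
  forall a : L, freq_to x [:: a] (mu (cyl [:: a])).
End Defs.

Definition ncount (S : set nat) (n : nat) : nat := count (fun i => `[< S i >]) (iota 0 n).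

(* k-th element (from 0) of S in increasing order: the n in S with exactly k
   elements of S below it (well-defined when S is infinite). *)
Definition enum_nth (S : set nat) (k : nat) : nat :=
  xget 0%N [set n | S n /\ ncount S n = k].

Definition subseq_at (L : Type) (x : nat -> L) (S : set nat) : nat -> L :=
  fun k => x (enum_nth S k).

Definition lower_density_zero (R : realType) (S : set nat) : Prop :=
  limn_einf (fun n : nat => ((ncount S n)%:R / n%:R : R)%:E) = 0%E.

(* Main.v *)
Require Import Defs.
From HB Require Import structures.
From mathcomp Require Import all_boot all_order all_algebra.
From mathcomp Require Import all_classical all_reals all_analysis.
From mathcomp Require Import zify ring lra.
Set Implicit Arguments. Unset Strict Implicit. Unset Printing Implicit Defensive.
Import Order.TTheory GRing.Theory Num.Theory.
Local Open Scope classical_set_scope.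
Local Open Scope ring_scope.

(** By shift invariance the [mu]-average over words [u] of length [N] of the
    number of occurrences of a block [B] in [u] is [N * mu [B]] up to [size B].
    Concatenating finitely many such words with multiplicities proportional to
    [mu [u]] gives finite words whose block frequencies approximate [mu]; no
    ergodicity is needed. Repeating better and better approximants, passing to
    the next one only when it is short compared to what precedes, yields a
    [mu]-normal point.

    Let [c n] be the number of elements of [S] below [n]. When [c n] is much
    smaller than [n], overwriting the elements of [S] of index in
    [[c n, 4 * c n)] by a symbol [a] with [mu [a] <= 1/2] changes only [3 * c n]
    entries, all beyond [n], but makes [a] fill three quarters of the first
    [4 * c n] terms of the subsequence. Doing this along a fast sequence of [n]
    changes [x] on a set of density zero, which preserves normality. *)

(** * Occurrences of blocks *)

Section Occurrences.
Variable L : pointedType.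
Implicit Types (x : nat -> L) (B u v w : seq L).

(** Only occurrences lying entirely inside [w] count, whereas a window counted by [nocc] may run
    past the first [n] terms. *)
Definition occ B w : nat :=
  count (fun i => prefix B (drop i w)) (iota 0 (size w)).

Lemma occ_cons B a w : occ B (a :: w) = (prefix B (a :: w) + occ B w)%N.
Proof.
rewrite /occ /=; congr addn.
by rewrite -[1%N]addn0 iotaDl count_map; apply: eq_count.
Qed.

Lemma occ_le_size B w : (occ B w <= size w)%N.
Proof. by rewrite -[leqRHS](size_iota 0) count_size. Qed.

Lemma prefix_cat_l B u v : (size B <= size u)%N -> prefix B (u ++ v) = prefix B u.
Proof. by move=> h; rewrite !prefixE takel_cat. Qed.

Lemma leq_occ_cat B u v : (occ B u + occ B v <= occ B (u ++ v))%N.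
Proof.
elim: u => [|a u IH]; first by rewrite /= /occ.
rewrite cat_cons !occ_cons.
have : (prefix B (a :: u) <= prefix B (a :: u ++ v))%N.
  case h : (prefix B (a :: u)) => //.
  by rewrite -[a :: u ++ v]/((a :: u) ++ v) prefix_cat_l ?h // size_prefix.
lia.
Qed.

(** New occurrences straddle the junction. The minimum lets the induction on [u] run: while [u] is
    shorter than [B], each of its letters pays for at most one of them. *)
Lemma occ_cat_leq B u v :
  (occ B (u ++ v) <= occ B u + occ B v + minn (size u) (size B))%N.
Proof.
elim: u => [|a u IH]; first by rewrite /= min0n; lia.
rewrite cat_cons !occ_cons -[size (a :: u)]/(size u).+1.
have [h|h] := leqP (size B) (size u).+1.
  have -> : prefix B (a :: u ++ v) = prefix B (a :: u).
    by rewrite -[a :: u ++ v]/((a :: u) ++ v) prefix_cat_l.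
  lia.
have := leq_b1 (prefix B (a :: u ++ v)); lia.
Qed.

Lemma drop_window x i k : drop i (window x 0 (i + k)) = window x i k.
Proof.
by rewrite /window iotaD map_cat drop_size_cat ?size_map ?size_iota //
  -[X in iota X]addn0 iotaDl -map_comp.
Qed.

Lemma nocc_shift x B n :
  nocc x B n.+1 = ((window x 0 (size B) == B) + nocc (Defs.shift x) B n)%N.
Proof.
rewrite /nocc /=; congr addn.
rewrite -[1%N]addn0 iotaDl count_map; apply: eq_count => i /=.
by congr (_ == _); apply: eq_map.
Qed.

Lemma mkseq_shift x n : mkseq x n.+1 = x 0%N :: mkseq (Defs.shift x) n.
Proof. by rewrite /mkseq /= -[1%N]addn0 iotaDl -map_comp. Qed.

(** The gap comes from windows that start before [n] and run past it. *)
Lemma nocc_occ x B n :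
  (occ B (mkseq x n) <= nocc x B n <= occ B (mkseq x n) + minn n (size B))%N.
Proof.
elim: n x => [|n IH] x; first by rewrite /occ /nocc.
rewrite nocc_shift mkseq_shift occ_cons -mkseq_shift.
have /andP[] := IH (Defs.shift x).
have [h|h] := leqP (size B) n.+1.
  have -> : prefix B (mkseq x n.+1) = (window x 0 (size B) == B).
    rewrite prefixE; congr (_ == _).
    by rewrite /mkseq /window -map_take take_iota (minn_idPl h).
  lia.
have -> : prefix B (mkseq x n.+1) = false.
  by apply/negP => /size_prefix; rewrite size_mkseq leqNgt h.
rewrite add0n (minn_idPl (ltnW (ltnW h))).
case: (_ == _) => /=; lia.
Qed.

End Occurrences.

(** A window where [y] reads [B] also reads [B] in [x] unless it meets [D]. The bound is a union
    over the offset in the window; the inner [size B] pays for points of [D] in the overhang beyond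
    [n]. *)
Lemma nocc_change (L : pointedType) (x y : nat -> L) (D : set nat) (B : seq L) n :
  (forall i, ~ D i -> y i = x i) ->
  (nocc y B n <= nocc x B n + size B * (ncount D n + size B))%N.
Proof.
move=> hD.
have bound j : (j <= size B)%N ->
   (count (fun i => `[< D (i + j)%N >]) (iota 0 n) <= ncount D n + size B)%N.
  move=> hj; rewrite -(count_map (fun i => i + j)%N (fun i => `[< D i >])).
  have -> : [seq (i + j)%N | i <- iota 0 n] = iota j n.
    by rewrite -[in RHS](addn0 j) iotaDl; apply: eq_map => i; rewrite addnC.
  have : (count (fun i => `[< D i >]) (iota 0 j)
          + count (fun i => `[< D i >]) (iota j n) <= 
         ncount D n + j)%N.
    rewrite -count_cat -[X in iota X n]add0n -iotaD addnC iotaD count_cat.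
    by rewrite leq_add2l -[leqRHS](size_iota n j) count_size.
  lia.
have bad k : (k <= size B)%N ->
    (count (fun i => has (fun j => `[< D (i + j)%N >]) (iota 0 k)) (iota 0 n)
      <= k * (ncount D n + size B))%N.
  elim: k => [|k IH] hk.
    by rewrite (eq_count (a2 := pred0)) ?count_pred0.
  rewrite mulSn addnC; apply: leq_trans (leq_add (IH (ltnW hk)) (bound k (ltnW hk))).
  rewrite -count_predUI; apply: leq_trans (leq_addr _ _).
  by apply: sub_count => i; rewrite -addn1 iotaD has_cat /= orbF.
apply: leq_trans (leq_add (leqnn _) (bad _ (leqnn _))).
rewrite -count_predUI; apply: leq_trans (leq_addr _ _).
apply: sub_count => i /= /eqP yB.
case hb : (has _ _); first by rewrite orbT.
rewrite orbF; apply/eqP; rewrite -[RHS]yB.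
apply/eq_in_map => j hj; rewrite hD // => Dij.
by move/hasPn: (negbT hb) => /(_ j hj) /asboolP.
Qed.

(** * Masses of cylinders *)

Lemma countable_seq (T : Type) : countable [set: T] -> countable [set: seq T].
Proof.
move=> /countable_injP[f finj].
apply/countable_injP; exists (fun s => pickle (map f s)) => s t _ _.
move=> /(pcan_inj pickleK) /inj_map; apply => a b fab.
by apply: finj => //; rewrite inE.
Qed.

Section CylinderMass.
Context (R : realType) (L : pointedType).
Hypothesis hcount : countable [set: L].
Variable mu : probability (seqspace L) R.
Implicit Types (B u : seq L) (U V : seq (seq L)).

Definition mass B : R := fine (mu (cyl B)).

Lemma measurable_cyl B : measurable (cyl B : set (seqspace L)).
Proof. by apply: sub_sigma_algebra; exists B. Qed.

(** Countability of the alphabet makes the event a countable union of cylinders. *)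
Lemma measurable_window (P : pred (seq L)) N :
  measurable ([set x | P (window x 0 N)] : set (seqspace L)).
Proof.
have -> : [set x | P (window x 0 N)] =
    \bigcup_u (if (size u == N) && P u then cyl u else set0).
  apply/seteqP; split=> [x /= Px|x [u _]].
    by exists (window x 0 N) => //; rewrite size_map size_iota eqxx Px /cyl /=
      size_map size_iota.
  by case: ifP => // /andP[/eqP <- Pu] /= ->.
apply: countable_bigcupT_measurable => [|u]; first exact: countable_seq.
by case: ifP => _; [exact: measurable_cyl | exact: measurable0].
Qed.

Lemma mass_ge0 B : 0 <= mass B.
Proof. exact/fine_ge0/measure_ge0. Qed.

Lemma massE B : mu (cyl B) = (mass B)%:E.
Proof. by rewrite fineK ?fin_num_measure//; exact: measurable_cyl. Qed.

Lemma mu_window_in V N : uniq V -> all (fun u => size u == N) V ->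
  mu [set x | window x 0 N \in V] = (\sum_(u <- V) mass u)%:E.
Proof.
elim: V => [|u V IH] /=.
  move=> _ _; rewrite big_nil -[RHS](measure0 mu); congr (mu _).
  by apply/seteqP; split => x.
move=> /andP[uV unV] /andP[/eqP su sV]; rewrite big_cons EFinD -IH // -massE.
rewrite -measureU //; [|exact: measurable_cyl|exact: measurable_window|].
  congr (mu _); apply/seteqP; split => x /=; rewrite inE /cyl /= su.
    by case/orP => [/eqP|]; [left | right].
  by case=> [->|->]; rewrite ?eqxx ?orbT.
apply/seteqP; split => x //=; rewrite /cyl /= su => -[->].
by rewrite (negbTE uV).
Qed.

Lemma mass_le1 B : mass B <= 1.
Proof.
by rewrite -lee_fin -massE; apply: probability_le1; exact: measurable_cyl.
Qed.

Lemma sum_mass_le1 V N : uniq V -> all (fun u => size u == N) V ->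
  \sum_(u <- V) mass u <= 1.
Proof.
move=> unV sV; rewrite -lee_fin -(mu_window_in unV sV).
by apply: probability_le1; exact: measurable_window.
Qed.

(** Over an infinite alphabet the words of length [N] need not be finitely many. Coding words
    injectively by integers, continuity from below along increasing codes leaves out arbitrarily
    little mass. *)
Lemma finite_words_tight N (e : R) : 0 < e ->
  exists V, [/\ uniq V, all (fun u => size u == N) V &
                1 - e < \sum_(u <- V) mass u].
Proof.
move=> e0.
have /countable_injP[g ginj] := countable_seq hcount.
pose F m := [set x | (g (window x 0 N) < m)%N] : set (seqspace L).
have F_cvg : mu \o F @ \oo --> mu (\bigcup_m F m).
  apply: nondecreasing_cvg_mu.
  - by move=> m; apply: (measurable_window (fun u => (g u < m)%N)).
  - by apply: bigcup_measurable => m _;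
      apply: (measurable_window (fun u => (g u < m)%N)).
  - by move=> m n mn; apply/subsetPset => x /= /leq_trans; apply.
have FT : \bigcup_m F m = setT.
  by apply/seteqP; split => x // _; exists (g (window x 0 N)).+1 => //; exact: ltnSn.
rewrite FT probability_setT in F_cvg.
have /fine_cvgP[_ /cvgrPdist_lt /(_ e e0) [m _ /(_ m (leqnn m)) /= Fm]] := F_cvg.
have [e' ge'] : exists e' : nat -> seq L, forall u, e' (g u) = u.
  have ginj' : injective g by move=> u v; apply: ginj; rewrite inE.
  exists (fun i => xget [::] [set u | g u = i]) => u.
  by apply: ginj'; apply: (@xgetPex _ [::] [set v | g v = g u]); exists u.
pose V := [seq u <- undup [seq e' i | i <- iota 0 m] | size u == N].
have unV : uniq V by rewrite filter_uniq ?undup_uniq.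
have sV : all (fun u => size u == N) V by rewrite filter_all.
exists V; split => //.
have : (fine (mu (F m)) <= \sum_(u <- V) mass u).
  rewrite -lee_fin fineK; last first.
    by rewrite fin_num_measure//; apply: (measurable_window (fun u => (g u < m)%N)).
  rewrite -(mu_window_in unV sV); apply: le_measure; rewrite ?inE.
  - exact: (measurable_window (fun u => (g u < m)%N)).
  - exact: measurable_window.
  - move=> x /= gm; rewrite mem_filter size_map size_iota eqxx mem_undup /=.
    by apply/mapP; exists (g (window x 0 N)); rewrite ?mem_iota // ge'.
move: Fm; rewrite ltr_distl => /andP[? ?]; lra.
Qed.

Hypothesis hinv : shift_invariant mu.

(** The only direct appeal to shift invariance: the window at [i.+1] is the window at [i] of the
    shifted point. *)
Lemma mu_window_at i B :
  mu [set x | window x i (size B) == B] = (mass B)%:E.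
Proof.
elim: i => [|i IH].
  by rewrite -massE; congr (mu _); apply/seteqP; split => x /= /eqP.
rewrite -IH -[RHS]hinv.
  congr (mu _); apply/seteqP; split => x /= /eqP <-; apply/eqP;
  by apply: eq_map => j; rewrite /Defs.shift addSn.
have -> : [set x | window x i (size B) == B] =
          [set x | drop i (window x 0 (i + size B)) == B].
  by apply/seteqP; split => x /=; rewrite drop_window.
exact: (measurable_window (fun u => drop i u == B)).
Qed.

(** The points whose first [N] letters are not in [V] have measure below [e], so restricting to [V]
    the event of reading [B] at [i] loses at most [e]. *)
Lemma sum_mass_at V N B i (e : R) :
  uniq V -> all (fun u => size u == N) V -> 1 - e < \sum_(u <- V) mass u ->
  (i + size B <= N)%N ->
  mass B - e <= \sum_(u <- V | prefix B (drop i u)) mass u <= mass B.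
Proof.
move=> unV sV eV iN.
pose W := [seq u <- V | prefix B (drop i u)].
have unW : uniq W by rewrite filter_uniq.
have sW : all (fun u => size u == N) W.
  by apply/allP => u; rewrite mem_filter => /andP[_ /(allP sV)].
pose A := [set x | prefix B (drop i (window x 0 N))] : set (seqspace L).
have mA : measurable A by exact: (measurable_window (fun u => prefix B (drop i u))).
have muA : mu A = (mass B)%:E.
  rewrite -(mu_window_at i); congr (mu _).
  have E x : prefix B (drop i (window x 0 N)) = (window x i (size B) == B).
    rewrite prefixE /window -map_drop -map_take drop_iota take_iota.
    have /minn_idPl-> : (size B <= N - i)%N by lia.
    by rewrite add0n -[X in iota X]addn0 iotaDl -map_comp.
  by apply/seteqP; split => x; rewrite /A /= E.
pose E := [set x | window x 0 N \in V] : set (seqspace L).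
have mE : measurable E by exact: (measurable_window (fun u => u \in V)).
have muE : mu E = (\sum_(u <- V) mass u)%:E by exact: mu_window_in.
have muW : mu [set x | window x 0 N \in W] =
           (\sum_(u <- V | prefix B (drop i u)) mass u)%:E.
  by rewrite mu_window_in // big_filter.
have mW : measurable ([set x | window x 0 N \in W] : set (seqspace L)).
  exact: (measurable_window (fun u => u \in W)).
apply/andP; split; last first.
  rewrite -lee_fin -muW -muA; apply: le_measure; rewrite ?inE //.
  by move=> x /=; rewrite mem_filter => /andP[].
have : (mu A <= mu [set x | window x 0 N \in W] + mu (~` E))%E.
  apply: le_trans (measureU2 _ _ _) => //; last exact: measurableC.
  apply: le_measure; rewrite ?inE //.
    by apply: measurableU => //; exact: measurableC.
  move=> x /= Ax; case: (boolP (window x 0 N \in V)) => h; [left|right].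
    by rewrite /= mem_filter h andbT.
  by rewrite /E /=; apply/negP.
rewrite probability_setC // muA muW muE -EFinB -EFinD lee_fin; lra.
Qed.

End CylinderMass.

(** * Finite words with prescribed frequencies *)

Lemma occ_flatten (L : pointedType) (B : seq L) (W : seq (seq L)) :
  (\sum_(u <- W) occ B u <= occ B (flatten W)
     <= \sum_(u <- W) occ B u + size W * size B)%N.
Proof.
elim: W => [|u W /andP[IHl IHr]]; first by rewrite big_nil.
rewrite big_cons -[flatten (u :: W)]/(u ++ flatten W) -[size (u :: W)]/(size W).+1.
rewrite mulSn; apply/andP; split.
  by apply: leq_trans (leq_occ_cat _ _ _); rewrite leq_add2l.
have := occ_cat_leq B u (flatten W); have := geq_minr (size u) (size B); lia.
Qed.

Section GoodWords.
Context (R : realType) (L : pointedType).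
Hypothesis hcount : countable [set: L].
Variable mu : probability (seqspace L) R.
Hypothesis hinv : shift_invariant mu.
Implicit Types (B u : seq L) (V : seq (seq L)).

(* The summand [size B] makes [dev mu B] subadditive under concatenation. *)
Definition dev B u : R :=
  `|(occ B u)%:R - mass mu B * (size u)%:R| + (size B)%:R.

(** Linearity of expectation: after exchanging sums, each position where [B] fits contributes
    [mass mu B] up to [e], and the final positions where it does not fit contribute nothing. *)
Lemma sum_mass_occ V N B (e : R) : 0 <= e -> (size B <= N)%N ->
  uniq V -> all (fun u => size u == N) V -> 1 - e < \sum_(u <- V) mass mu u ->
  N%:R * mass mu B - N%:R * e - (size B)%:R
    <= \sum_(u <- V) mass mu u * (occ B u)%:R <= N%:R * mass mu B.
Proof.
move=> e0 BN unV sV eV.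
pose t i : R := \sum_(u <- V | prefix B (drop i u)) mass mu u.
have -> : \sum_(u <- V) mass mu u * (occ B u)%:R = \sum_(0 <= i < N) t i.
  rewrite /t; under [RHS]eq_bigr do rewrite big_mkcond.
  rewrite exchange_big /= !big_seq; apply: eq_bigr => u /(allP sV) /eqP su.
  rewrite /occ su -sum1_count natr_sum mulr_sumr -big_mkcond.
  by rewrite /index_iota subn0; apply: eq_bigr => i _; rewrite mulr1.
have t0 i : 0 <= t i by apply: sumr_ge0 => u _; exact: mass_ge0.
have tle i : (i < N)%N -> t i <= mass mu B.
  move=> ltiN.
  have [iN|iN] := leqP (i + size B) N.
    by have /andP[] := sum_mass_at hcount hinv unV sV eV iN.
  rewrite /t big_seq_cond big_pred0 ?mass_ge0 // => u.
  apply/negP => /andP[/(allP sV) /eqP su /size_prefix].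
  rewrite size_drop su (leq_subRL _ (ltnW ltiN)).
  by rewrite leqNgt iN.
apply/andP; split; last first.
  rewrite mulr_natl -[X in _ *+ X]subn0 -sumr_const_nat !big_seq.
  by apply: ler_sum => i; rewrite mem_index_iota => /andP[_ /tle].
rewrite (big_cat_nat _ (n := (N - size B)%N)) //= ?leq_subr //.
apply: le_trans (lerD (_ : (N - size B)%N%:R * (mass mu B - e) <= _) (sumr_ge0 _ _));
  [|rewrite mulr_natl -[X in _ *+ X]subn0 -sumr_const_nat |by move=> i _; exact: t0].
  rewrite addr0 natrB //.
  have := mass_le1 mu B; have := mass_ge0 mu B.
  have : 0 <= (size B)%:R :> R by []. 
  nra.
rewrite !big_seq; apply: ler_sum => i; rewrite mem_index_iota => /andP[_ iN].
have iN' : (i + size B <= N)%N by move: iN BN; lia.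
by have /andP[] := sum_mass_at hcount hinv unV sV eV iN'.
Qed.

(** The word concatenates the elements [u] of a finite family [V], each repeated about
    [M * mass mu u] times. *)
Lemma good_word k : exists w : seq L, (0 < size w)%N /\
  forall B, (size B <= k)%N -> dev B w * k.+1%:R <= (size w)%:R.
Proof.
(* These values give [N * e = K], so a junction loss of [size B <= K] per word of length [N] is a
   proportion [e], and [K * e = 1/16], which absorbs the constants of the final estimate. *)
pose K : R := k.+1%:R; pose N := (16 * k.+1 ^ 2)%N; pose e : R := (16 * K)^-1.
have K1 : 1 <= K by rewrite ler1n.
have e0 : 0 < e by rewrite invr_gt0; lra.
have Ke : K * e = 16^-1 by rewrite /e; field; lra.
have NE : N%:R * e = K.
  by rewrite /e /N natrM natrX -/K; field; lra.
have [V [unV sV eV]] := finite_words_tight hcount mu N e0.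
pose n : R := (size V)%:R.
(* Chosen so that [M * e = n + 1]: rounding the [n] multiplicities down then costs less than [M * e]
   copies in all. *)
pose M : R := 16 * K * (n + 1).
have n0 : 0 <= n by [].
have Me : M * e = n + 1 by rewrite /e /M; field; lra.
have M0 : 0 <= M by rewrite /M; nra.
pose mult u := Num.trunc (M * mass mu u).
have multP u : M * mass mu u - 1 <= (mult u)%:R <= M * mass mu u.
  have := @truncn_itv _ (M * mass mu u) (mulr_ge0 M0 (mass_ge0 _ _)).
  by rewrite -natr1 => /andP[-> /ltW]; rewrite andbT lerBlDr.
pose W := flatten [seq nseq (mult u) u | u <- V].
have sumW (f : seq L -> nat) :
    (\sum_(u <- W) f u)%N%:R = \sum_(u <- V) (mult u)%:R * (f u)%:R :> R.
  rewrite big_flatten big_map natr_sum; apply: eq_bigr => u _.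
  by rewrite big_nseq -natrM; congr _%:R; elim: (mult u) => //= m ->; rewrite mulSn.
pose T : R := (size W)%:R.
have TE : T = \sum_(u <- V) (mult u)%:R.
  by rewrite /T -sum1_size sumW; apply: eq_bigr => u _; rewrite mulr1.
have sW : (size (flatten W))%:R = N%:R * T :> R.
  rewrite size_flatten /shape sumnE big_map sumW TE mulr_sumr.
  rewrite !big_seq; apply: eq_bigr => u /(allP sV) /eqP ->.
  by rewrite mulrC.
have T0 : 0 <= T by [].
have TM : T <= M.
  rewrite TE; apply: le_trans (ler_sum _ (fun u _ => proj2 (andP (multP u)))) _.
  rewrite -mulr_sumr; have := sum_mass_le1 hcount mu unV sV.
  by move: M0; nra.
have TM' : M * (1 - e) - n <= T.
  have : \sum_(u <- V) (M * mass mu u - 1) <= T.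
    by rewrite TE; apply: ler_sum => u _; case/andP: (multP u).
  rewrite sumrB -mulr_sumr big_const_seq count_predT iter_addr addr0 -/n.
  have : 0 <= M * (\sum_(u <- V) mass mu u - (1 - e)).
    by rewrite mulr_ge0 // subr_ge0 ltW.
  lra.
have N1 : 1 <= N%:R :> R by rewrite ler1n.
have TK : M <= 2 * T.
  have : n <= M * e by lra. have : e <= 16^-1 by nra. 
  nra.
have M1 : 1 <= M by rewrite /M; nra.
clearbody M e.
exists (flatten W); split.
  rewrite -(ltr0n R) sW mulr_gt0; lra.
move=> B Bk; rewrite /dev sW.
set b : R := (size B)%:R; set p := mass mu B.
have bK : b <= K by rewrite ler_nat leqW.
have BN : (size B <= N)%N.
  apply: leq_trans (leqW Bk) (leq_trans _ (leq_pmull _ _)) => //.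
  by rewrite -[X in (X <= _)%N]expn1 leq_pexp2l.
have /andP[Al Ar] := sum_mass_occ (ltW e0) BN unV sV eV.
have /andP[] := occ_flatten B W.
rewrite -!(ler_nat R) natrD natrM sumW -/b -/T.
set O := \sum_(u <- V) _ => Ol Or.
set Q := (occ B (flatten W))%:R in Ol Or *.
set A := \sum_(u <- V) _ in Al Ar.
have OA : O <= M * A.
  rewrite /O /A mulr_sumr; apply: ler_sum => u _; rewrite mulrA ler_wpM2r //.
  by case/andP: (multP u).
have AO : M * A - n * N%:R <= O.
  have -> : n * N%:R = \sum_(u <- V) N%:R.
    by rewrite big_const_seq count_predT iter_addr addr0 /n mulrC mulr_natr.
  rewrite /O /A mulr_sumr -sumrB !big_seq; apply: ler_sum => u /(allP sV) /eqP su.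
  have : (occ B u)%:R <= N%:R :> R by rewrite ler_nat -su occ_le_size.
  have /andP[] := multP u.
  have : 0 <= (occ B u)%:R :> R by [].
  set o := (occ B u)%:R; set m := (mult u)%:R; nra.
have p0 : 0 <= p := mass_ge0 mu B.
have p1 : p <= 1 := mass_le1 mu B.
have b0 : 0 <= b by [].
(* The length of the concatenation if there were no rounding and [V] had full mass. Errors are
   counted in units of [X * e]: three for the occurrences, two for the length, one for the summand
   [size B]. *)
set X := M * N%:R.
have Mb : M * b <= X * e by rewrite /X -mulrA NE ler_wpM2l.
have nN : n * N%:R <= X * e.
  by rewrite /X mulrAC Me ler_wpM2r //; lra.
have pNT : `|p * (N%:R * T) - p * X| <= 2 * X * e.
  rewrite /X; rewrite ler_norml; apply/andP; split.
    have : N%:R * (M - T) <= N%:R * (M * e + n).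
      by rewrite ler_wpM2l //; lra.
    have : 0 <= N%:R * (M - T) by rewrite mulr_ge0 //; lra.
    rewrite /X in nN; set Y := N%:R * (M - T) => Y0 Yle.
    have -> : p * (N%:R * T) - p * (M * N%:R) = - (p * Y) by rewrite /Y; ring.
    have : p * Y <= Y by nra.
    lra.
  have : 0 <= p * (N%:R * (M - T)).
    by rewrite !mulr_ge0 //; lra.
  have : 0 <= M * N%:R * e by rewrite !mulr_ge0 // (ltW e0).
  lra.
have QX : `|Q - p * X| <= 3 * X * e.
  rewrite ler_norml; apply/andP; split.
    have : M * (N%:R * p - N%:R * e - b) <= M * A by rewrite ler_wpM2l.
    rewrite /X in nN Mb *; lra.
  have : M * A <= M * (N%:R * p) by rewrite ler_wpM2l.
  have : T * b <= M * b by rewrite ler_wpM2r.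
  have : 0 <= M * N%:R * e by rewrite !mulr_ge0 // (ltW e0).
  rewrite /X in nN Mb *; lra.
have bX : b <= X * e by apply: le_trans Mb; rewrite ler_peMl.
have dX : `|Q - p * (N%:R * T)| + b <= 6 * X * e.
  have -> : Q - p * (N%:R * T) = (Q - p * X) - (p * (N%:R * T) - p * X) by ring.
  have := ler_normB (Q - p * X) (p * (N%:R * T) - p * X); lra.
apply: le_trans (ler_wpM2r _ dX) _; first by [].
have -> : 6 * X * e * k.+1%:R = 6 * X * (K * e) by rewrite /K; ring.
rewrite Ke /X.
have : N%:R * M <= N%:R * (2 * T) by rewrite ler_wpM2l.
have : 0 <= N%:R * T by rewrite mulr_ge0.
lra.
Qed.

End GoodWords.

(** * Existence of normal points *)

(** Bounds [C + e * n] for every [e] express an error that is small compared to [n]; unlike limits,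
    they add up directly and [C] absorbs any initial segment. *)
Lemma freq_to_of_bound (R : realType) (L : pointedType) (x : nat -> L) B (p : R) :
  (forall e : R, 0 < e -> exists C : R, forall n,
     `|(nocc x B n)%:R - p * n%:R| <= C + e * n%:R) ->
  freq_to x B p%:E.
Proof.
move=> h; apply/fine_cvgP; split; first by near=> n.
apply/cvgrPdist_le => e e0.
have [C hC] := h (e / 2) (divr_gt0 e0 (ltr0n _ 2)).
near=> n => /=.
have n1 : 1 <= n%:R :> R by near: n; exact: nbhs_infty_ger.
have nC : C <= n%:R * (e / 2).
  rewrite -ler_pdivrMr ?divr_gt0 //.
  by near: n; exact: nbhs_infty_ger.
have n0 : 0 < n%:R :> R by apply: lt_le_trans n1.
have -> : p - (nocc x B n)%:R / n%:R = - (((nocc x B n)%:R - p * n%:R) / n%:R).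
  by field; rewrite lt0r_neq0.
rewrite normrN normrM normfV (gtr0_norm n0) ler_pdivrMr //.
have := hC n; lra.
Unshelve. all: by end_near.
Qed.

Section NormalPoint.
Context (R : realType) (L : pointedType).
Hypothesis hcount : countable [set: L].
Variable mu : probability (seqspace L) R.
Hypothesis hinv : shift_invariant mu.
Implicit Types (B u v : seq L).

Lemma dev_cat B u v : dev mu B (u ++ v) <= dev mu B u + dev mu B v.
Proof.
rewrite /dev size_cat natrD.
have := leq_occ_cat B u v; rewrite -(ler_nat R) natrD.
have : (occ B (u ++ v) <= occ B u + occ B v + size B)%N.
  by apply: leq_trans (occ_cat_leq B u v) _; rewrite leq_add2l geq_minr.
rewrite -(ler_nat R) !natrD.
set a := (occ B u)%:R; set b := (occ B v)%:R; set c := (occ B (u ++ v))%:R.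
set s := (size u)%:R; set t := (size v)%:R; set p := mass mu B => h1 h2.
have -> : c - p * (s + t) = (a - p * s) + (b - p * t) + (c - a - b) by ring.
have := ler_normD (a - p * s + (b - p * t)) (c - a - b).
have := ler_normD (a - p * s) (b - p * t).
have : `|c - a - b| <= (size B)%:R by rewrite ler_norml; lra.
lra.
Qed.

(** A crude bound for the initial segment and for the truncated last block, where no frequency
    estimate is available. *)
Lemma dev_le_size B u : dev mu B u <= (size u)%:R + (size B)%:R.
Proof.
rewrite /dev lerD2r ler_norml.
have := occ_le_size B u; rewrite -(ler_nat R).
have := mass_ge0 mu B; have := mass_le1 mu B.
have : 0 <= (occ B u)%:R :> R by [].
have : 0 <= (size u)%:R :> R by [].
nra.
Qed.

(** The summand [size B] of [dev] also absorbs the windows running past [n]. *)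
Lemma nocc_dev (x : nat -> L) B n :
  `|(nocc x B n)%:R - mass mu B * n%:R| <= dev mu B (mkseq x n).
Proof.
have /andP[] := nocc_occ x B n.
rewrite /dev size_mkseq => l r.
have : (nocc x B n <= occ B (mkseq x n) + size B)%N.
  by apply: leq_trans r _; rewrite leq_add2l geq_minr.
move: l; rewrite -!(ler_nat R) natrD => h1 h2.
rewrite -[X in `|X|](subrK ((occ B (mkseq x n))%:R - mass mu B * n%:R)) addrC.
apply: le_trans (ler_normD _ _) _; rewrite lerD2l ler_norml; lra.
Qed.

Lemma normal_point_exists : exists x : nat -> L, forall B (e : R), 0 < e ->
  exists C : R, forall n,
    `|(nocc x B n)%:R - mass mu B * n%:R| <= C + e * n%:R.
Proof.
have [w w_gt0 w_dev] : exists2 w : nat -> seq L, forall k, (0 < size (w k))%N &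
    forall k B, (size B <= k)%N -> dev mu B (w k) * k.+1%:R <= (size (w k))%:R.
  have [w hw] := choice (good_word hcount hinv).
  by exists w => k; case: (hw k).
(* [k j] is the largest level whose word is short compared to [j]: slow enough
   for each block to be negligible in the prefix preceding it. *)
pose k j := \max_(k < j.+1 | (k * size (w k) <= j)%N) (k : nat).
have k_size j : (k j * size (w (k j)) <= j)%N.
  rewrite /k; apply: (big_ind (fun m => (m * size (w m) <= j)%N)) => //.
  by move=> a b ha hb; rewrite /maxn; case: ifP.
have k_large K j : (K * size (w K) + K <= j)%N -> (K <= k j)%N.
  move=> h; have Kj : (K < j.+1)%N by rewrite ltnS; apply: leq_trans h; rewrite leq_addl.
  apply: (leq_bigmax_cond (Ordinal Kj)) => /=.
  by apply: leq_trans h; rewrite leq_addr.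
pose v j := w (k j).
pose F J := flatten [seq v j | j <- iota 0 J].
have FS J : F J.+1 = F J ++ v J.
  by rewrite /F -addn1 iotaD map_cat flatten_cat /= cats0.
have F_prefix a b : (a <= b)%N -> exists t, F b = F a ++ t.
  move=> /subnKC <-; rewrite /F iotaD map_cat flatten_cat; by eexists.
have F_mono a b : (a <= b)%N -> (size (F a) <= size (F b))%N.
  by move=> /F_prefix[t ->]; rewrite size_cat leq_addr.
have F_size J : (J <= size (F J))%N.
  elim: J => // J IH; rewrite FS size_cat -addn1 leq_add //; exact: w_gt0.
(* The default is never reached: every block is nonempty, so [F n.+1] has more than [n] letters. *)
pose x n := nth point (F n.+1) n.
have xE n J : (n <= size (F J))%N -> mkseq x n = take n (F J).
  move=> nJ; apply: (@eq_from_nth _ point); first by rewrite size_mkseq size_takel.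
  move=> i; rewrite size_mkseq => ltin; rewrite nth_mkseq // nth_take // /x.
  have [le|/ltnW le] := leqP i.+1 J; have [t ->] := F_prefix _ _ le.
    by rewrite nth_cat F_size.
  by rewrite nth_cat (leq_trans ltin nJ).
exists x => B e0 e0_gt0; pose e := e0 / 2.
have e_gt0 : 0 < e by rewrite /e divr_gt0.
(* Levels from [K] on control [B], with relative error at most [1 / K <= e]; from index [j0] on,
   only such levels occur. *)
pose K := ((Num.trunc e^-1).+1 + size B)%N.
have eK : 1 <= e * K%:R.
  have : e^-1 <= K%:R.
    apply: le_trans (ltW (truncnS_gt _)) _.
    by rewrite ler_nat leq_addr.
  by rewrite -[e in e * _]invrK ler_pdivlMl ?invr_gt0 // mulr1.
pose j0 := (K * size (w K) + K)%N.
have v_dev j : (j0 <= j)%N -> dev mu B (v j) <= e * (size (v j))%:R.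
  move=> /k_large Kk.
  have Bk : (size B <= k j)%N by apply: leq_trans Kk; rewrite leq_addl.
  have h := w_dev _ _ Bk; have d0 : 0 <= dev mu B (v j) by rewrite addr_ge0.
  have : dev mu B (v j) * K%:R <= (size (v j))%:R.
    by apply: le_trans h; rewrite ler_wpM2l // ler_nat leqW.
  move=> /(ler_wpM2l (ltW e_gt0)); apply: le_trans.
  by rewrite mulrCA ler_peMr.
have v_size j : (j0 <= j)%N -> (size (v j))%:R <= e * j%:R.
  move=> /k_large Kk.
  have : (K * size (v j) <= j)%N by apply: leq_trans (k_size j); rewrite leq_mul2r Kk orbT.
  rewrite -(ler_nat R) natrM => /(ler_wpM2l (ltW e_gt0)); apply: le_trans.
  by rewrite mulrA ler_peMl.
pose C0 : R := (size (F j0))%:R + (size B)%:R.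
(* By subadditivity, blocks before [j0] are paid for by [C0] and each later one by [e] times its own
   length. *)
have F_dev J : dev mu B (F J) <= C0 + e * (size (F J))%:R.
  elim: J => [|J IH].
    rewrite /F /dev /occ /= /C0 !mulr0 subrr normr0 add0r addr0 lerDr //.
  have [h|h] := leqP J.+1 j0.
    apply: le_trans (dev_le_size _ _) _; rewrite -[leLHS]addr0 lerD //.
      by rewrite /C0 lerD2r ler_nat F_mono.
    by rewrite mulr_ge0 // ltW.
  rewrite FS; apply: le_trans (dev_cat _ _ _) _.
  rewrite size_cat natrD mulrDr [leRHS]addrA; apply: lerD => //; exact: v_dev.
exists (C0 + (size (F j0))%:R + (size B)%:R) => n.
apply: le_trans (nocc_dev _ _ _) _.
have [J SJ SJ1] : exists2 J, (size (F J) <= n)%N & (n < size (F J.+1))%N.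
  have ex : exists J, (size (F J) <= n)%N by exists 0%N.
  have ub J : (size (F J) <= n)%N -> (J <= n)%N by apply: leq_trans.
  case: (ex_maxnP ex ub) => J SJ Jmax; exists J => //.
  by rewrite ltnNge; apply/negP => /Jmax; rewrite ltnn.
rewrite (xE n J.+1) ?(ltnW SJ1) // FS take_cat ltnNge SJ /=.
apply: le_trans (dev_cat _ _ _) _.
have tv : dev mu B (take (n - size (F J)) (v J)) <= (size (v J))%:R + (size B)%:R.
  apply: le_trans (dev_le_size _ _) _; rewrite lerD2r ler_nat size_take.
  by case: ifP => // /ltnW.
(* The block cut at [n] is either part of [F j0] or has length at most [e * J], and [J <= n]. It
   uses the second half of [e0]. *)
have vJ : (size (v J))%:R <= (size (F j0))%:R + e * n%:R.
  have en : 0 <= e * n%:R by rewrite mulr_ge0 // ltW.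
  have [h|h] := leqP j0 J.
    apply: le_trans (v_size _ h) _.
    rewrite -[leLHS]add0r lerD // ler_wpM2l ?(ltW e_gt0) // ler_nat.
    exact: leq_trans (F_size J) SJ.
  rewrite -[leLHS]addr0 lerD // ler_nat; apply: leq_trans (F_mono _ _ h).
  by rewrite FS size_cat leq_addl.
have FJ : e * (size (F J))%:R <= e * n%:R.
  by rewrite ler_wpM2l ?(ltW e_gt0) // ler_nat.
have := F_dev J; have -> : e0 = 2 * e by rewrite /e; field.
lra.
Qed.

End NormalPoint.

(** * Sets of lower density zero *)

Lemma ncountS (S : set nat) n : ncount S n.+1 = (ncount S n + `[< S n >])%N.
Proof. by rewrite /ncount -addn1 iotaD count_cat /= addn0. Qed.

Lemma ncount_le (S : set nat) n : (ncount S n <= n)%N.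
Proof. by rewrite -[leqRHS](size_iota 0 n) count_size. Qed.

Lemma leq_ncount (S : set nat) m n : (m <= n)%N -> (ncount S m <= ncount S n)%N.
Proof.
by move=> /subnKC <-; rewrite /ncount iotaD count_cat leq_addr.
Qed.

Lemma ncount_sub (A B : set nat) n :
  (forall i, (i < n)%N -> A i -> B i) -> (ncount A n <= ncount B n)%N.
Proof.
elim: n => // n IH h; rewrite !ncountS leq_add ?IH //.
  by move=> i ltin; apply: h; exact: ltnW.
by case: (asboolP (A n)) => // An; rewrite (asboolT (h _ _ An)).
Qed.

Lemma ncount_initial (S : set nat) K n :
  (ncount [set s | S s /\ (ncount S s < K)%N] n <= minn (ncount S n) K)%N.
Proof.
elim: n => [|n IH]; first by rewrite /ncount.
rewrite !ncountS.
case: (asboolP (S n)) => Sn; last first.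
  by rewrite asboolF ?addn0 // => -[].
have [h|h] := ltnP (ncount S n) K.
  by rewrite asboolT //; move: IH h; rewrite !leq_min; lia.
by rewrite asboolF; [move: IH h; rewrite !leq_min; lia|move=> []; lia].
Qed.

Section InfiniteSet.
Variable S : set nat.
Hypothesis hS : infinite_set S.

Lemma ncount_unbounded k : exists n, (k <= ncount S n)%N.
Proof.
elim: k => [|k [n kn]]; first by exists 0%N.
have [s ns Ss] : exists2 s, (n <= s)%N & S s.
  apply: contrapT => h; apply: hS; apply: (@sub_finite_set _ _ `I_n) => //.
  move=> s Ss /=; rewrite ltnNge; apply/negP => ns; apply: h; by exists s.
exists s.+1; rewrite ncountS asboolT // addn1 ltnS.
exact: leq_trans kn (leq_ncount _ ns).
Qed.

(** The least [n] with more than [k] elements of [S] below it is the successor of the element of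
    rank [k], so [enum_nth] does not fall back on its default. *)
Lemma enum_nthP k : S (enum_nth S k) /\ ncount S (enum_nth S k) = k.
Proof.
rewrite /enum_nth.
apply: (@xgetPex _ 0%N [set n | S n /\ ncount S n = k]).
case: (ex_minnP (ncount_unbounded k.+1)) => -[|n]; first by rewrite /ncount.
rewrite ncountS => kn nmin; exists n.
have nk : (ncount S n <= k)%N.
  by rewrite leqNgt; apply/negP => /nmin; rewrite ltnn.
move: kn; case: asboolP => Sn /=; rewrite ?addn1 ?addn0 => kn; split => //; lia.
Qed.

End InfiniteSet.

(** Otherwise the ratio would be at least [1 / (j + 1)] from some index on, and so would its lower
    limit. Using [j.+1] keeps the inverse positive when [j] is zero. *)
Lemma lower_density_zero_small (R : realType) (S : set nat) :
  lower_density_zero R S ->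
  forall j N, exists2 n, (N <= n)%N & (j * ncount S n <= n)%N.
Proof.
move=> hS j N; apply: contrapT => h.
have {}h n : (N.+1 <= n)%N -> j.+1%:R^-1 <= (ncount S n)%:R / n%:R :> R.
  move=> Nn; have n0 : 0 < n%:R :> R by rewrite ltr0n; lia.
  rewrite ler_pdivlMr // mulrC ler_pdivrMr // -natrM ler_nat.
  have [?|nj] := leqP (j * ncount S n) n; last by nia.
  by exfalso; apply: h; exists n => //; exact: ltnW.
suff : ((j.+1%:R^-1)%:E <= 0%:E :> \bar R)%E.
  by rewrite lee_fin leNgt invr_gt0 ltr0Sn.
rewrite -[leRHS]hS limn_einf_lim; apply: lime_ge; first exact: is_cvg_einfs.
exists N.+1 => // m /= Nm; apply: le_ereal_inf_tmp => _ [i /= mi <-].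
by rewrite lee_fin h // (leq_trans Nm).
Qed.

(* Stage [j] covers a proportion [3/4] of the first [4 * c j] elements of [S]
   by at most [4 * c j <= n j / j] points, all of them beyond [n j]. *)
Lemma sparse_majority_subset (R : realType) (S : set nat) :
  infinite_set S -> lower_density_zero R S ->
  exists D : set nat,
    (forall e : R, 0 < e -> exists C : R, forall n,
       (ncount D n)%:R <= C + e * n%:R) /\
    (forall m, exists2 c, (m < c)%N &
       forall k, (c <= k < 4 * c)%N -> D (enum_nth S k)).
Proof.
move=> infS /lower_density_zero_small small.
have small4 (jN : nat * nat) : exists n,
    (jN.2 <= n)%N /\ (4 * jN.1 * ncount S n <= n)%N.
  by have [n] := small (4 * jN.1)%N jN.2; exists n.
have [g gP] := choice small4.
(* The stages increase strictly, and the factor 4 in [small4] anticipates that stage [j] overwrites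
   ranks up to [4 * c j]. *)
pose ns := fix ns j := if j is i.+1 then g (j, (ns i).+1) else g (0%N, 0%N).
have ns_small j : (4 * j * ncount S (ns j) <= ns j)%N.
  by case: j => [|j]; [have [] := gP (0%N, 0%N)|have [] := gP (j.+1, (ns j).+1)].
have ns_lt j : (ns j < ns j.+1)%N.
  by have [] := gP (j.+1, (ns j).+1).
have ns_mono : {homo ns : i j / (i <= j)%N}.
  by apply: homo_leq => // [i|i]; [exact: leq_trans|exact: ltnW].
have ns_ge j : (j <= ns j)%N.
  by elim: j => // j IH; exact: leq_ltn_trans IH (ns_lt j).
pose c j := ncount S (ns j).
(* For [s] in [S], [ns j <= s] means rank at least [c j], so stage [j] consists of the ranks from
   [c j] to [4 * c j - 1]. *)
pose D := [set s | S s /\ exists j, (ns j <= s)%N /\ (ncount S s < 4 * c j)%N].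
exists D; split => [e e0|m].
  pose j0 := (Num.trunc e^-1).+1.
  have ej0 : 1 <= e * j0%:R.
    by rewrite -[e]invrK ler_pdivlMl ?invr_gt0 // mulr1 ltW // truncnS_gt.
  exists (ns j0)%:R => n.
  have en : 0 <= e * n%:R by rewrite mulr_ge0 // ltW.
  have [nj0|/ltnW nj0] := leqP (ns j0) n; last first.
    rewrite -[leLHS]addr0 lerD // ler_nat.
    exact: leq_trans (ncount_le _ _) nj0.
  have [J SJ SJ1] : exists2 J, (ns J <= n)%N & (n < ns J.+1)%N.
    have ex : exists J, (ns J <= n)%N by exists j0.
    have ub J : (ns J <= n)%N -> (J <= n)%N by apply: leq_trans.
    case: (ex_maxnP ex ub) => J SJ Jmax; exists J => //.
    by rewrite ltnNge; apply/negP => /Jmax; rewrite ltnn.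
  have j0J : (j0 <= J)%N.
    by rewrite leqNgt; apply/negP => /ns_mono h; move: (leq_trans SJ1 h); lia.
  (* Below [n] only stages up to [J] have begun, and [c] is monotone, so these points are among the
     first [4 * c J] elements of [S]. *)
  have DJ : (ncount D n <= 4 * c J)%N.
    apply: leq_trans (leq_trans (ncount_initial S _ n) (geq_minr _ _)).
    apply: ncount_sub => s sn [Ss [j [js cs]]]; split => //.
    apply: leq_trans cs _; rewrite leq_mul2l /= leq_ncount // ns_mono //.
    rewrite leqNgt; apply/negP => /ns_mono h; lia.
  have : (j0 * ncount D n <= n)%N.
    apply: leq_trans (leq_mul j0J DJ) _; apply: leq_trans SJ.
    by apply: leq_trans (ns_small J); rewrite mulnCA mulnA.
  rewrite -(ler_nat R) natrM => /(ler_wpM2l (ltW e0)) h.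
  rewrite -[leLHS]add0r lerD //; apply: le_trans h.
  by rewrite mulrA ler_peMl.
(* This [n] serves as a stage index: [n <= ns n] gives [m < c n]. *)
have [n mn] := ncount_unbounded infS m.+1.
exists (c n); first by apply: leq_trans mn (leq_ncount _ _).
move=> k /andP[ck kc]; have [Sk Ek] := enum_nthP infS k.
split => //; exists n; split; last by rewrite Ek.
rewrite leqNgt; apply/negP => h.
have : (ncount S (enum_nth S k).+1 <= c n)%N by apply: leq_ncount.
by rewrite ncountS asboolT // Ek addn1 ltnNge ck.
Qed.

Theorem mainTheorem3 (R : realType) (L : pointedType)
  (hcount : countable [set: L]) (h2 : exists a b : L, a <> b)
  (mu : probability (seqspace L) R) (hinv : shift_invariant mu)
  (S : set nat) (hSinf : infinite_set S) (hS : lower_density_zero R S) :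
  exists x : nat -> L, normal mu x /\ ~ simply_normal mu (subseq_at x S).
Proof.
have [x hx] := normal_point_exists hcount hinv.
have [D [Dsparse Dmost]] := sparse_majority_subset hSinf hS.
(* Two distinct symbols have total mass at most 1, so one of them has at most half. *)
have [a pa] : exists a : L, mass mu [:: a] <= 2^-1.
  have [a [b /eqP ab]] := h2.
  have := @sum_mass_le1 _ _ hcount mu [:: [:: a]; [:: b]] 1%N.
  rewrite /= inE !big_cons big_nil addr0 andbT.
  have -> : [:: a] != [:: b] by apply: contra ab => /eqP[->].
  move=> /(_ isT isT) h.
  have [|] := lerP (mass mu [:: a]) 2^-1; first by exists a.
  by exists b; lra.
pose y i := if `[< D i >] then a else x i.
have yx i : ~ D i -> y i = x i by move=> nD; rewrite /y asboolF.
exists y; split.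
  move=> B; rewrite massE; apply: freq_to_of_bound => e e0.
  have [C1 hC1] := hx B (e / 2) (divr_gt0 e0 (ltr0n _ 2)).
  (* Half of [e] goes to [x] and half to the overwriting, where a point of [D] spoils at most
     [size B] windows; the successor avoids dividing by zero for the empty block. *)
  have b0 : 0 < 2 * (size B).+1%:R :> R by rewrite mulr_gt0.
  have [C2 hC2] := Dsparse (e / (2 * (size B).+1%:R)) (divr_gt0 e0 b0).
  exists (C1 + (size B).+1%:R * (C2 + (size B)%:R)) => n.
  have h1 := nocc_change B n yx.
  have h2' := nocc_change B n (fun i nD => esym (yx i nD)).
  have {}h1 : (nocc y B n <= nocc x B n + (size B).+1 * (ncount D n + size B))%N.
    by apply: leq_trans h1 _; rewrite leq_add2l leq_mul2r leqnSn orbT.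
  have {}h2' : (nocc x B n <= nocc y B n + (size B).+1 * (ncount D n + size B))%N.
    by apply: leq_trans h2' _; rewrite leq_add2l leq_mul2r leqnSn orbT.
  move: h1 h2'; rewrite -!(ler_nat R) !natrD !natrM !natrD => h1 h2'.
  have := hC2 n; rewrite -(ler_pM2l (x := (size B).+1%:R)) ?ltr0Sn // mulrDr.
  have -> : (size B).+1%:R * (e / (2 * (size B).+1%:R) * n%:R) = e / 2 * n%:R.
    have : (size B).+1%:R != 0 :> R by rewrite pnatr_eq0.
    by move: (size B).+1%:R => q q0; field.
  have := hC1 n; rewrite ler_norml => /andP[l r] hD.
  rewrite ler_norml; apply/andP; split; lra.
move=> /(_ a); rewrite massE => /fine_cvgP[_ /cvgrPdist_lt].
(* At length [4 * c] the frequency of [a] is at least 3/4 while its mass is at most 1/2, so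
   tolerance 1/4 is violated. *)
move=> /(_ 4^-1 _)[|m _ hm]; first by rewrite invr_gt0.
have [c mc Dc] := Dmost m.
have c0 : 0 < c%:R :> R by rewrite ltr0n; lia.
have : (3 * c <= nocc (subseq_at y S) [:: a] (4 * c))%N.
  rewrite /nocc -[(4 * c)%N]/(c + 3 * c)%N iotaD count_cat add0n.
  apply: leq_trans (leq_addl _ _).
  rewrite -[leqLHS](size_iota c (3 * c)).
  set occurs := (X in count X); suff : all occurs (iota c (3 * c)).
    by rewrite all_count => /eqP ->.
  apply/allP => k; rewrite mem_iota => kc; rewrite /occurs.
  by rewrite /window /= addn0 /subseq_at /y asboolT //; exact: Dc.
rewrite -(ler_nat R) natrM => h.
have /= := hm (4 * c)%N; rewrite ltr_distl.
have -> : (m <= 4 * c)%N by lia.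
move=> /(_ isT) /andP[+ _].
apply/negP; rewrite -leNgt.
have : 3 / 4 <= (nocc (subseq_at y S) [:: a] (4 * c))%:R / (4 * c)%N%:R :> R.
  rewrite ler_pdivlMr ?natrM; last by rewrite mulr_gt0.
  by apply: le_trans h; rewrite mulrA divfK.
lra.
Qed.
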